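(* Let $d\ge1$ be an integer. For any $p=(p_0,\dots,p_d)\in\mathcal{D}_d$, $$\mathcal{H}^{2^d-d-1}(\mathcal{P}(p))=\prod_{k=0}^d\mathcal{H}^{n_k}(\Delta_{n_k,\sqrt{2}p_k}),\qquad n_k=\binom{d}{k}-1.$$
   Context: $\mathcal{D}_d$ is the simplex of probability mass functions $p=(p_0,\dots,p_d)$ on $\{0,\dots,d\}$. $\mathcal{P}(p)\subset\mathbb{R}^{2^d}$ is the set of probability mass functions $f=(f(x))_{x\in\{0,1\}^d}$ on $\{0,1\}^d$ such that, if $(X_1,\dots,X_d)$ has probability mass function $f$, then $\sum_{i=1}^dX_i$ has probability mass function $p$. For an integer $n\ge0$ and real $q\ge0$, $\Delta_{n,\sqrt{2}q}=\{y\in\mathbb{R}^{n+1}:y_j\ge0,\ j=0,\dots,n,\ \sum_{h=0}^ny_h=q\}$. $\mathcal{H}^n$ is the $n$-dimensional Hausdorff measure, normalized to agree with Lebesgue measure on $\mathbb{R}^n$; $\mathcal{H}^0$ is counting measure, so a single point has $\mathcal{H}^0$-measure $1$. *)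

(* Defs.v *)
From HB Require Import structures.
From mathcomp Require Import all_boot all_order all_algebra.
From mathcomp Require Import all_classical all_reals all_analysis.

Set Implicit Arguments.
Unset Strict Implicit.
Unset Printing Implicit Defensive.

Import Order.TTheory GRing.Theory Num.Theory.

Local Open Scope classical_set_scope.
Local Open Scope ring_scope.

(* The Euclidean space R^I (I a finite index type) is {ffun I -> R}.  The      *)
(* normed-space structure of the library on row vectors is not used, since     *)
(* it comes from the sup norm.                                                 *)
Definition euclid_dist (R : realType) (I : finType) (x y : {ffun I -> R}) : R :=
  Num.sqrt (\sum_i (x i - y i) ^+ 2).

Local Open Scope ereal_scope.

Definition ediam (R : realType) (I : finType) (A : set {ffun I -> R}) :
    \bar R :=
  ereal_sup [set (euclid_dist z.1 z.2)%:E | z in A `*` A].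

(* (diam A)^n, with the usual conventions: 0 for the empty set, and, since     *)
(* 0 ^+ 0 = 1, the value 1 for a nonempty set when n = 0.                      *)
Definition ediam_pow (R : realType) (I : finType) (n : nat)
    (A : set {ffun I -> R}) : \bar R :=
  if A == set0 then 0 else ediam A ^+ n.

Definition hausdorff_content (R : realType) (I : finType) (n : nat)
    (delta : R) (A : set {ffun I -> R}) : \bar R :=
  ereal_inf [set \sum_(0 <= i <oo) ediam_pow n (U i) |
    U in [set U : nat -> set {ffun I -> R} |
      A `<=` \bigcup_i U i /\ forall i, ediam (U i) <= delta%:E]].

(* The limit of the contents as delta tends to 0, i.e. their supremum.         *)
Definition hausdorff_unnormalized (R : realType) (I : finType) (n : nat)
    (A : set {ffun I -> R}) : \bar R :=
  ereal_sup [set hausdorff_content n delta A | delta in [set r : R | (0 < r)%R]].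

Definition unit_cube (R : realType) (n : nat) : set {ffun 'I_n -> R} :=
  [set x | forall i, (0 <= x i <= 1)%R].

(* The normalization making H^n agree with Lebesgue measure on R^n: the unit   *)
(* cube of R^n has measure 1.                                                  *)
Definition hausdorff (R : realType) (I : finType) (n : nat)
    (A : set {ffun I -> R}) : \bar R :=
  hausdorff_unnormalized n A / hausdorff_unnormalized n (@unit_cube R n).

Local Close Scope ereal_scope.

Definition is_pmf (R : realType) (T : finType) (f : {ffun T -> R}) : Prop :=
  (forall x, 0 <= f x) /\ \sum_x f x = 1.

Definition law (R : realType) (T : finType) (f : {ffun T -> R}) (S : T -> nat)
    (k : nat) : R :=
  \sum_(x | S x == k) f x.

Definition bits_sum (d : nat) (x : {ffun 'I_d -> bool}) : nat :=
  (\sum_(i < d) x i)%N.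

(* P(p): the mass functions on {0,1}^d whose coordinate sum has mass function  *)
(* p.                                                                          *)
Definition pmf_with_sum (R : realType) (d : nat) (p : {ffun 'I_d.+1 -> R}) :
    set {ffun {ffun 'I_d -> bool} -> R} :=
  [set f | is_pmf f /\ forall k : 'I_d.+1, law f (@bits_sum d) k = p k].

(* Delta_{n, sqrt 2 q}: the first index is the dimension, and sqrt 2 q is the  *)
(* edge length; q is the sum of the coordinates.                               *)
Definition simplex (R : realType) (n : nat) (q : R) : set {ffun 'I_n.+1 -> R} :=
  [set y | (forall j, 0 <= y j) /\ \sum_j y j = q].

(* Main.v *)
Require Import Defs.
From HB Require Import structures.
From mathcomp Require Import all_boot all_order all_algebra.
From mathcomp Require Import all_classical all_reals all_analysis.
From mathcomp Require Import measurable_realfun ring lra.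

(* Write h for the unnormalized Hausdorff measure of dimension n and c_n for
   the h-measure of the unit cube of R^n, which is positive and finite.
   Grouping the points of {0,1}^d by coordinate sum, P(p) is the product of the
   simplices Delta_k, and each simplex is isometric to a set A_k in R^(n_k).
   Call A in R^n fat if t A has a margin inside A for every t < 1.  For a fine
   enough grid of mesh 1/m, the cells contained in a fat A cover t A, and they
   become separated once slightly shrunk.  Hence
   t^n h(A) <= c_n #cells / m^n <= h(A), so h(A) / c_n is a limit of normalized
   cell counts, and the number of cells inside a product set is the product of
   the numbers of cells inside the factors.  The set A_k is fat unless p_k = 0
   and n_k > 0, in which case both sides vanish. *)

Set Implicit Arguments.
Unset Strict Implicit.
Unset Printing Implicit Defensive.

Import Order.TTheory GRing.Theory Num.Theory.

Local Open Scope classical_set_scope.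
Local Open Scope ring_scope.

(** * Euclidean distance and diameters *)

Section Distance.
Variables (R : realType) (I : finType).
Implicit Types x y : {ffun I -> R}.

Lemma euclid_dist_ge0 x y : 0 <= euclid_dist x y.
Proof. exact: sqrtr_ge0. Qed.

Lemma euclid_distxx x : euclid_dist x x = 0.
Proof. by rewrite /euclid_dist big1 ?sqrtr0// => i _; rewrite subrr expr0n. Qed.

Lemma coord_le_euclid_dist x y i : `|x i - y i| <= euclid_dist x y.
Proof.
rewrite -sqrtr_sqr /euclid_dist ler_wsqrtr// (bigD1 i)//= lerDl sumr_ge0//.
by move=> j _; exact: sqr_ge0.
Qed.

Lemma euclid_dist_eq0 x y : euclid_dist x y = 0 -> x = y.
Proof.
move=> e; apply/ffunP => i; apply/eqP; rewrite -subr_eq0 -normr_le0 -e.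
exact: coord_le_euclid_dist.
Qed.

Lemma euclid_dist_le_sup x y (s : R) : 0 <= s ->
  (forall i, `|x i - y i| <= s) -> euclid_dist x y <= Num.sqrt #|I|%:R * s.
Proof.
move=> s0 h; rewrite -[s in leRHS]ger0_norm// -sqrtr_sqr -sqrtrM ?ler0n//.
apply: ler_wsqrtr; rewrite mulr_natl -sumr_const; apply: ler_sum => i _.
by rewrite -real_normK ?num_real// lerXn2r ?nnegrE.
Qed.

Lemma euclid_distZ x y (a : R) :
  euclid_dist [ffun i => a * x i] [ffun i => a * y i] = `|a| * euclid_dist x y.
Proof.
rewrite -sqrtr_sqr -sqrtrM ?sqr_ge0// /euclid_dist; congr Num.sqrt.
by rewrite mulr_sumr; apply: eq_bigr => i _; rewrite !ffunE -exprMn mulrBr.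
Qed.

Lemma euclid_distD x y (v : {ffun I -> R}) :
  euclid_dist [ffun i => x i + v i] [ffun i => y i + v i] = euclid_dist x y.
Proof.
by congr Num.sqrt; apply: eq_bigr => i _; rewrite !ffunE; congr (_ ^+ 2); ring.
Qed.

Local Open Scope ereal_scope.
Implicit Types A B : set {ffun I -> R}.

Lemma euclid_dist_le_ediam A x y : A x -> A y -> (euclid_dist x y)%:E <= ediam
  A.
Proof. by move=> Ax Ay; apply: ereal_sup_ubound; exists (x, y). Qed.

Lemma ediam_le A (r : \bar R) :
  (forall x y, A x -> A y -> (euclid_dist x y)%:E <= r) -> ediam A <= r.
Proof. by move=> h; apply: ge_ereal_sup => _ [[x y] [/= Ax Ay]] <-;
  exact: h. Qed.

Lemma ediam_sub A B : A `<=` B -> ediam A <= ediam B.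
Proof. by move=> AB; apply: ediam_le => x y /AB ? /AB ?;
  exact: euclid_dist_le_ediam. Qed.

Lemma ediam_fin A (delta : R) : A !=set0 -> ediam A <= delta%:E ->
  exists2 D : R, (0 <= D)%R & ediam A = D%:E.
Proof.
move=> [x Ax] h; have h0 := euclid_dist_le_ediam Ax Ax.
have f : ediam A \is a fin_num.
  by rewrite fin_numElt (lt_le_trans _ h0) ?ltNyr// (le_lt_trans h)// ltry.
exists (fine (ediam A)); last by rewrite fineK.
by rewrite -lee_fin fineK// (le_trans _ h0)// lee_fin euclid_dist_ge0.
Qed.

Lemma ediam_pow0 n : ediam_pow n (set0 : set {ffun I -> R}) = 0.
Proof. by rewrite /ediam_pow eqxx. Qed.

Lemma ediam_powE n A (D : R) : A !=set0 -> ediam A = D%:E ->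
  ediam_pow n A = (D ^+ n)%:E.
Proof. by move=> /set0P/negbTE A0 h; rewrite /ediam_pow A0 h EFin_expe. Qed.

Lemma ediam_pow_ge0 n A : 0 <= ediam_pow n A.
Proof.
rewrite /ediam_pow; case: ifPn => // /set0P[x Ax]; apply: expe_ge0.
by apply: le_trans (euclid_dist_le_ediam Ax Ax);
  rewrite lee_fin euclid_dist_ge0.
Qed.

Lemma ediam_pow_le n A (D : R) : (0 <= D)%R ->
  (forall x y, A x -> A y -> (euclid_dist x y <= D)%R) ->
  ediam_pow n A <= (D ^+ n)%:E.
Proof.
move=> D0 h; have [->|A0] := pselect (A = set0).
  by rewrite ediam_pow0 lee_fin exprn_ge0.
have A0' : A !=set0 by apply/set0P/eqP.
have hD : ediam A <= D%:E by apply: ediam_le => x y Ax Ay; rewrite lee_fin h.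
have [D' D'0 e] := ediam_fin A0' hD.
rewrite (ediam_powE n A0' e) lee_fin lerXn2r ?nnegrE//.
by rewrite -lee_fin -e.
Qed.

Lemma ediam_pow_sub n A B (delta : R) : A `<=` B -> ediam B <= delta%:E ->
  ediam_pow n A <= ediam_pow n B.
Proof.
move=> AB hB; have [->|A0] := pselect (A = set0).
  by rewrite ediam_pow0 ediam_pow_ge0.
have A0' : A !=set0 by apply/set0P/eqP.
have B0 : B !=set0 by case: A0' => x /AB ?; exists x.
have [D D0 e] := ediam_fin B0 hB.
rewrite (ediam_powE n B0 e); apply: ediam_pow_le => // x y Ax Ay.
by rewrite -lee_fin -e; apply: euclid_dist_le_ediam; exact: AB.
Qed.

End Distance.

Lemma ediam_pow_image (R : realType) (I J : finType) n (A : set {ffun I -> R})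
    (f : {ffun I -> R} -> {ffun J -> R}) (L delta : R) :
  (0 <= L)%R -> (ediam A <= delta%:E)%E ->
  (forall x y, A x -> A y -> euclid_dist (f x) (f y) <= L * euclid_dist x y) ->
  (ediam_pow n (f @` A) <= (L ^+ n)%:E * ediam_pow n A)%E.
Proof.
move=> L0 hA h; have [->|A0] := pselect (A = set0).
  by rewrite image_set0 !ediam_pow0 mule0.
have A0' : A !=set0 by apply/set0P/eqP.
have [D D0 e] := ediam_fin A0' hA.
rewrite (ediam_powE n A0' e) -EFinM -exprMn; apply: ediam_pow_le.
  exact: mulr_ge0.
move=> _ _ [x Ax <-] [y Ay <-]; apply: (le_trans (h _ _ Ax Ay)).
by rewrite ler_wpM2l// -lee_fin -e euclid_dist_le_ediam.
Qed.

(** If one infimum is infinite, so is the sum, the other infimum being nonnegative; otherwise take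
    elements within e / 2 of the two infima. This serves to combine nearly optimal covers of two
    sets. *)
Lemma le_adde_ereal_inf (R : realType) (S T : set \bar R) (x : \bar R) :
  (forall y, S y -> (0 <= y)%E) -> (forall z, T z -> (0 <= z)%E) ->
  (forall y z, S y -> T z -> (x <= y + z)%E) ->
  (x <= ereal_inf S + ereal_inf T)%E.
Proof.
move=> S0 T0 h.
have iS : (0 <= ereal_inf S)%E by apply: le_ereal_inf_tmp.
have iT : (0 <= ereal_inf T)%E by apply: le_ereal_inf_tmp.
have [fS|] := boolP (ereal_inf S \is a fin_num); last first.
  by rewrite ge0_fin_numE// -leNgt leye_eq => /eqP ->;
    rewrite addye ?leey// gt_eqF// (lt_le_trans _ iT) ?ltNyr.
have [fT|] := boolP (ereal_inf T \is a fin_num); last first.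
  by rewrite ge0_fin_numE// -leNgt leye_eq => /eqP ->;
    rewrite addey ?leey// gt_eqF// (lt_le_trans _ iS) ?ltNyr.
apply/lee_addgt0Pr => e e0.
have e2 : 0 < e / 2 by rewrite divr_gt0.
have [y Sy hy] := lb_ereal_inf_adherent e2 fS.
have [z Tz hz] := lb_ereal_inf_adherent e2 fT.
apply: (le_trans (h _ _ Sy Tz)); apply: (le_trans (leeD (ltW hy) (ltW hz))).
by rewrite addeACA -EFinD -splitr.
Qed.

(** * Hausdorff contents: subadditivity, and additivity on separated sets *)

Section Content.
Local Open Scope ereal_scope.
Variables (R : realType) (I : finType) (n : nat).
Implicit Types A B : set {ffun I -> R}.

Local Notation h := (@hausdorff_unnormalized R I n).

Lemma hausdorff_content_le (delta : R) A (U : nat -> set {ffun I -> R}) :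
  A `<=` \bigcup_i U i -> (forall i, ediam (U i) <= delta%:E) ->
  hausdorff_content n delta A <= \sum_(0 <= i <oo) ediam_pow n (U i).
Proof. by move=> AU hU; apply: ereal_inf_lbound; exists U. Qed.

Lemma le_hausdorff_content (delta : R) A (r : \bar R) :
  (forall U, A `<=` \bigcup_i U i -> (forall i, ediam (U i) <= delta%:E) ->
    r <= \sum_(0 <= i <oo) ediam_pow n (U i)) ->
  r <= hausdorff_content n delta A.
Proof. by move=> hr; apply: le_ereal_inf_tmp => _ [U [AU hU]] <-;
  exact: hr. Qed.

Lemma hausdorff_content_ge0 (delta : R) A : 0 <= hausdorff_content n delta A.
Proof.
by apply: le_hausdorff_content => U _ _; apply: nneseries_ge0 => *;
  exact: ediam_pow_ge0.
Qed.

Lemma hausdorff_content_le_unnormalized (delta : R) A : (0 < delta)%R ->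
  hausdorff_content n delta A <= h A.
Proof. by move=> d0; apply: ereal_sup_ubound; exists delta. Qed.

Lemma hausdorff_unnormalized_le A (r : \bar R) :
  (forall delta : R, (0 < delta)%R -> hausdorff_content n delta A <= r) -> h A
    <= r.
Proof. by move=> hr; apply: ge_ereal_sup => _ [delta d0] <-; exact: hr. Qed.

Lemma hausdorff_unnormalized_ge0 A : 0 <= h A.
Proof.
exact: le_trans (hausdorff_content_ge0 1 A)
  (hausdorff_content_le_unnormalized A ltr01).
Qed.

Lemma hausdorff_content_antitone (delta delta' : R) A : (delta <= delta')%R ->
  hausdorff_content n delta' A <= hausdorff_content n delta A.
Proof.
move=> dd; apply: le_hausdorff_content => U AU hU;
  apply: hausdorff_content_le => // i.
by apply: le_trans (hU i) _; rewrite lee_fin.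
Qed.

Lemma hausdorff_content_sub (delta : R) A B : A `<=` B ->
  hausdorff_content n delta A <= hausdorff_content n delta B.
Proof.
move=> AB; apply: le_hausdorff_content => U BU hU;
  apply: hausdorff_content_le => //.
exact: subset_trans BU.
Qed.

Lemma hausdorff_unnormalized_sub A B : A `<=` B -> h A <= h B.
Proof.
move=> AB; apply: hausdorff_unnormalized_le => delta d0.
apply: le_trans (hausdorff_content_le_unnormalized B d0).
exact: hausdorff_content_sub.
Qed.

Lemma ediam0_le (delta : R) : ediam (set0 : set {ffun I -> R}) <= delta%:E.
Proof. by apply: ediam_le. Qed.

(** Cover A by itself, followed by empty sets, which cost 0 even when n = 0. *)
Lemma hausdorff_content_le_ediam_pow (delta : R) A : ediam A <= delta%:E ->
  hausdorff_content n delta A <= ediam_pow n A.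
Proof.
move=> hA; pose U i : set {ffun I -> R} := if i == 0%N then A else set0.
have := @hausdorff_content_le delta A U; rewrite (nneseriesD1 (n := 0%N))//;
  last first.
  by move=> *; exact: ediam_pow_ge0.
rewrite eseries0 ?adde0; last first.
  by move=> i _ /= i0; rewrite /U (negbTE i0) ediam_pow0.
apply => [x Ax|i]; first by exists 0%N.
by rewrite /U; case: ifP => // _; exact: ediam0_le.
Qed.

Lemma hausdorff_content0 (delta : R) :
  hausdorff_content n delta (set0 : set {ffun I -> R}) = 0.
Proof.
apply/eqP; rewrite eq_le hausdorff_content_ge0 andbT.
by rewrite -(@ediam_pow0 R I n) hausdorff_content_le_ediam_pow ?ediam0_le.
Qed.

(** Interleave a cover of A, at the even indices, with a cover of B, at the odd ones; the first 2N
    terms of the new series are N terms of each. *)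
Lemma hausdorff_contentU (delta : R) A B :
  hausdorff_content n delta (A `|` B) <=
  hausdorff_content n delta A + hausdorff_content n delta B.
Proof.
apply: le_adde_ereal_inf.
- by move=> _ [U _ <-]; apply: nneseries_ge0 => *; exact: ediam_pow_ge0.
- by move=> _ [U _ <-]; apply: nneseries_ge0 => *; exact: ediam_pow_ge0.
move=> _ _ [U [AU hU] <-] [V [BV hV] <-].
pose W i := if odd i then V i./2 else U i./2.
have W2 i : W i.*2 = U i by rewrite /W odd_double doubleK.
have W21 i : W i.*2.+1 = V i by rewrite /W /= odd_double/= uphalf_double.
apply: (@le_trans _ _ (\sum_(0 <= i <oo) ediam_pow n (W i))).
  apply: hausdorff_content_le => [x [/AU[i _ Ux]|/BV[i _ Vx]]|i].
  - by exists i.*2; rewrite ?W2.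
  - by exists i.*2.+1; rewrite ?W21.
  - by rewrite /W; case: ifP.
apply: lime_le; first by apply: is_cvg_nneseries => *; exact: ediam_pow_ge0.
apply: nearW => N.
apply: (@le_trans _ _ (\sum_(0 <= i < N.*2) ediam_pow n (W i))).
  apply: lee_sum_nneg_natr => //.
    by move=> *; exact: ediam_pow_ge0.
  by rewrite -addnn leq_addr.
apply: (@le_trans _ _ (\sum_(0 <= i < N) ediam_pow n (U i) +
    \sum_(0 <= i < N) ediam_pow n (V i))).
  elim: N => [|N ih]; first by rewrite !big_geq// adde0.
  rewrite doubleS !big_nat_recr//= W2 W21 [leRHS]addeACA -[leLHS]addeA.
  by apply: leeD.
by apply: leeD; apply: nneseries_lim_ge => *; exact: ediam_pow_ge0.
Qed.

Lemma hausdorff_content_bigcup (delta : R) (V : finType) (P : pred V)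
    (A : V -> set {ffun I -> R}) :
  hausdorff_content n delta (\bigcup_(v in [set v | P v]) A v) <=
  \sum_(v | P v) hausdorff_content n delta (A v).
Proof.
suff H (s : seq V) :
    hausdorff_content n delta (\bigcup_(v in [set v | v \in s /\ P v]) A v) <=
    \sum_(v <- s | P v) hausdorff_content n delta (A v).
  apply: le_trans (H (index_enum V));
    apply: hausdorff_content_sub => x [v Pv Ax].
  by exists v => //; split => //; rewrite mem_index_enum.
elim: s => [|v s ih].
  rewrite big_nil [X in hausdorff_content _ _ X](_ : _ = set0)
    ?hausdorff_content0//.
  by apply/seteqP; split => // x [? []].
rewrite big_cons; case: ifPn => Pv; last first.
  apply: le_trans ih; apply: hausdorff_content_sub.
  move=> x [w [/[!inE]/orP[/eqP->|ws]] Pw Aw]; first by rewrite Pw in Pv.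
  by exists w.
apply: (@le_trans _ _ (hausdorff_content n delta
    (A v `|` \bigcup_(v in [set v | v \in s /\ P v]) A v))).
  apply: hausdorff_content_sub => x [w [/[!inE]/orP[/eqP->|ws]] Pw Aw].
    by left.
  by right; exists w.
by apply: (le_trans (hausdorff_contentU _ _ _)); rewrite leeD2l.
Qed.

Lemma hausdorff_unnormalized_bigcup (V : finType) (P : pred V)
    (A : V -> set {ffun I -> R}) :
  h (\bigcup_(v in [set v | P v]) A v) <= \sum_(v | P v) h (A v).
Proof.
apply: hausdorff_unnormalized_le => delta d0.
apply: (le_trans (hausdorff_content_bigcup _ _ _)).
by apply: lee_sum => v _; exact: hausdorff_content_le_unnormalized.
Qed.

(** A set of diameter at most delta < eta cannot meet both A and B, so each member of a cover of the
    union is charged to one side only. *)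
Lemma hausdorff_contentU_separated (delta eta : R) A B : (delta < eta)%R ->
  (forall x y, A x -> B y -> (eta <= euclid_dist x y)%R) ->
  hausdorff_content n delta A + hausdorff_content n delta B <=
  hausdorff_content n delta (A `|` B).
Proof.
move=> de sep; apply: le_hausdorff_content => U ABU hU.
have e (C D : set {ffun I -> R}) : D `<=` \bigcup_i U i ->
    hausdorff_content n delta D <= \sum_(0 <= i <oo) ediam_pow n (U i `&` D).
  move=> DU; apply: hausdorff_content_le => [x Dx|i].
    by have [i _ Ux] := DU _ Dx; exists i.
  by apply: le_trans (hU i); apply: ediam_sub => x [].
apply: (@le_trans _ _ (\sum_(0 <= i <oo) ediam_pow n (U i `&` A) +
   \sum_(0 <= i <oo) ediam_pow n (U i `&` B))).
  by apply: leeD; apply: e => //; apply: subset_trans ABU => x ?; [left|right].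
rewrite -nneseriesD; [|by move=> *; exact: ediam_pow_ge0..].
apply: lee_nneseries => [*|i _]; first by rewrite adde_ge0// ediam_pow_ge0.
have [A0|A0] := pselect (U i `&` A = set0).
  by rewrite A0 ediam_pow0 add0e (ediam_pow_sub _ _ (hU i)).
suff -> : U i `&` B = set0.
  by rewrite ediam_pow0 adde0 (ediam_pow_sub _ _ (hU i)).
move/eqP/set0P : A0 => [x [Ux Ax]].
apply/seteqP; split => // y [Uy By].
have := le_trans (euclid_dist_le_ediam Ux Uy) (hU i).
by rewrite lee_fin leNgt (lt_le_trans de (sep _ _ Ax By)).
Qed.

(** The two suprema on the left run over independent scales d and d'; both contents are compared at
    a scale m below d, d' and eta, where the separated inequality for contents applies. *)
Lemma hausdorff_unnormalizedU_separated (eta : R) A B : (0 < eta)%R ->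
  (forall x y, A x -> B y -> (eta <= euclid_dist x y)%R) ->
  h A + h B <= h (A `|` B).
Proof.
move=> e0 sep.
(* An infinite right-hand side is trivial; otherwise all terms are finite and can be moved across
   the inequality. *)
have [fAB|] := boolP (h (A `|` B) \is a fin_num); last first.
  rewrite ge0_fin_numE ?hausdorff_unnormalized_ge0//.
  by rewrite -leNgt leye_eq => /eqP ->; rewrite leey.
have sub C : C `<=` A `|` B -> h C \is a fin_num.
  move=> CAB; rewrite ge0_fin_numE ?hausdorff_unnormalized_ge0//.
  apply: (le_lt_trans (hausdorff_unnormalized_sub CAB)).
  by rewrite -ge0_fin_numE ?hausdorff_unnormalized_ge0.
have fA : h A \is a fin_num by apply: sub => x; left.
have fB : h B \is a fin_num by apply: sub => x; right.
rewrite -leeBrDr//; apply: hausdorff_unnormalized_le => d d0.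
rewrite leeBrDr// addeC -leeBrDr; last first.
  rewrite ge0_fin_numE ?hausdorff_content_ge0//.
  by rewrite (le_lt_trans (hausdorff_content_le_unnormalized A d0))//
    -ge0_fin_numE ?hausdorff_unnormalized_ge0.
apply: hausdorff_unnormalized_le => d' d'0.
rewrite leeBrDr; last first.
  rewrite ge0_fin_numE ?hausdorff_content_ge0//.
  by rewrite (le_lt_trans (hausdorff_content_le_unnormalized A d0))//
    -ge0_fin_numE ?hausdorff_unnormalized_ge0.
pose m : R := Num.min (Num.min d d') (eta / 2)%R.
have m0 : (0 < m)%R by rewrite !lt_min d0 d'0 divr_gt0.
have md : (m <= d)%R by rewrite !ge_min lexx.
have md' : (m <= d')%R by rewrite !ge_min lexx orbT.
have me : (m < eta)%R.
  by rewrite /m gt_min; apply/orP; right; rewrite ltr_pdivrMr// ltr_pMr// ltr1n.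
apply: le_trans (hausdorff_content_le_unnormalized _ m0).
apply: le_trans (hausdorff_contentU_separated me sep).
by rewrite addeC; apply: leeD; exact: hausdorff_content_antitone.
Qed.

Lemma hausdorff_unnormalized_bigcup_separated (V : finType) (P : pred V)
    (eta : R)
    (A : V -> set {ffun I -> R}) : (0 < eta)%R ->
  (forall v w, P v -> P w -> v != w ->
    forall x y, A v x -> A w y -> (eta <= euclid_dist x y)%R) ->
  \sum_(v | P v) h (A v) <= h (\bigcup_(v in [set v | P v]) A v).
Proof.
move=> e0 sep.
suff H (s : seq V) : uniq s -> \sum_(v <- s | P v) h (A v) <=
    h (\bigcup_(v in [set v | v \in s /\ P v]) A v).
  apply: le_trans (H (index_enum V) (index_enum_uniq V)) _.
  by apply: hausdorff_unnormalized_sub => x [v [_ Pv] Ax]; exists v.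
elim: s => [_|v s ih /= /andP[vs us]].
  by rewrite big_nil hausdorff_unnormalized_ge0.
rewrite big_cons; case: ifPn => Pv; last first.
  apply: (le_trans (ih us));
    apply: hausdorff_unnormalized_sub => x [w [ws Pw] Aw].
  by exists w => //; split => //; rewrite inE ws orbT.
apply: (@le_trans _ _ (h (A v) + h (\bigcup_(v in [set v | v \in s /\ P v]) A
  v))).
  by rewrite leeD2l// ih.
apply: le_trans.
  apply: (hausdorff_unnormalizedU_separated e0) => x y Ax [w [ws Pw] Aw].
  by apply: (sep v w) => //; apply: contraNneq vs => ->.
apply: hausdorff_unnormalized_sub => x [Ax|[w [ws Pw] Aw]].
  by exists v => //; split => //; rewrite inE eqxx.
by exists w => //; split => //; rewrite inE ws orbT.
Qed.

End Content.

(** * Lipschitz maps and similarities *)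

Lemma hausdorff_unnormalized_lipschitz (R : realType) (I J : finType) n
    (A : set {ffun I -> R}) (f : {ffun I -> R} -> {ffun J -> R}) (L : R) :
  0 < L ->
  (forall x y, A x -> A y -> euclid_dist (f x) (f y) <= L * euclid_dist x y) ->
  (hausdorff_unnormalized n (f @` A) <=
   (L ^+ n)%:E * hausdorff_unnormalized n A)%E.
Proof.
move=> L0 fL; apply: hausdorff_unnormalized_le => delta d0.
have Ln0 : 0 < L ^+ n by rewrite exprn_gt0.
have d'0 : 0 < delta / L by rewrite divr_gt0.
apply: (@le_trans _ _ ((L ^+ n)%:E * hausdorff_content n (delta / L) A)%E);
  last first.
  by rewrite lee_pmul2l ?lte_fin// hausdorff_content_le_unnormalized.
rewrite -lee_pdivrMl//; apply: le_hausdorff_content => U AU hU.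
rewrite lee_pdivrMl// -nneseriesZl; last by move=> *; exact: ediam_pow_ge0.
(* Since f is controlled only on A, the covering sets are cut down to A before taking images. *)
apply: (@le_trans _ _ (\sum_(0 <= i <oo) ediam_pow n (f @` (U i `&` A)))%E).
  apply: hausdorff_content_le => [_ [x Ax <-]|i].
    by have [i _ Ux] := AU _ Ax; exists i => //; exists x.
  apply: ediam_le => _ _ [x [Ux Ax] <-] [y [Uy Ay] <-].
  rewrite lee_fin (le_trans (fL _ _ Ax Ay))// mulrC -ler_pdivlMr// -lee_fin.
  exact: le_trans (euclid_dist_le_ediam Ux Uy) (hU i).
apply: lee_nneseries => [*|i _]; first exact: ediam_pow_ge0.
have hUA : (ediam (U i `&` A) <= (delta / L)%:E)%E.
  by apply: le_trans (hU i); apply: ediam_sub => x [].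
apply: (le_trans (ediam_pow_image n (ltW L0) hUA _)).
  by move=> x y [_ Ax] [_ Ay]; exact: fL.
by rewrite lee_pmul2l ?lte_fin// (ediam_pow_sub _ _ (hU i)).
Qed.

Lemma hausdorff_unnormalized_similarity (R : realType) (I J : finType) n
    (A : set {ffun I -> R}) (f : {ffun I -> R} -> {ffun J -> R}) (L : R) :
  0 < L ->
  (forall x y, A x -> A y -> euclid_dist (f x) (f y) = L * euclid_dist x y) ->
  (hausdorff_unnormalized n (f @` A) =
   (L ^+ n)%:E * hausdorff_unnormalized n A)%E.
Proof.
move=> L0 fL; apply/eqP; rewrite eq_le hausdorff_unnormalized_lipschitz//=;
  last first.
  by move=> x y Ax Ay; rewrite fL.
(* [g] chooses preimages in A. As f scales distances by L > 0, [g] inverts f and is Lipschitz with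
   constant 1 / L, which gives the reverse inequality. *)
pose g y := xget 0 [set x | A x /\ f x = y].
have gP y : (f @` A) y -> A (g y) /\ f (g y) = y.
  by move=> [x Ax fx]; apply: (xgetPex 0 (P := [set x | A x /\ f x = y]));
    exists x.
have gf x : A x -> g (f x) = x.
  move=> Ax; have [Ag fg] := gP _ (imageP f Ax).
  apply: euclid_dist_eq0; apply/(mulfI (lt0r_neq0 L0)).
  by rewrite -fL// fg euclid_distxx mulr0.
have Ln0 : 0 < L ^+ n by rewrite exprn_gt0.
have gA : A = g @` (f @` A).
  apply/seteqP; split => [x Ax|_ [_ [x Ax <-] <-]]; last by rewrite gf.
  by exists (f x); rewrite ?gf//; exact: imageP.
rewrite -lee_pdivlMl// -exprVn [X in hausdorff_unnormalized n X]gA.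
apply: hausdorff_unnormalized_lipschitz; first by rewrite invr_gt0.
move=> _ _ [x Ax <-] [y Ay <-];
  rewrite !gf// fL// mulrA mulVf ?lt0r_neq0// mul1r.
exact: lexx.
Qed.

(** * Cubes have positive and finite measure *)

(* The coordinates of x are integrated out over [0, 1] one at a time. *)
Lemma weighted_box_cover (R : realType) n (w l : nat -> R)
    (a : nat -> nat -> R) :
  (forall i, 0 <= w i) -> (forall i, 0 <= l i) ->
  (forall x : nat -> R, (forall j, 0 <= x j <= 1) ->
    (1 <= \sum_(0 <= i <oo)
      (w i * \prod_(j < n) \1_(`[a i j - l i, a i j + l i]) (x j))%:E)%E) ->
  (1 <= \sum_(0 <= i <oo) (w i * (2 * l i) ^+ n)%:E)%E.
Proof.
move=> + l0; elim: n w => [|n ih] w w0 hw.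
  have := hw (fun=> 0); under eq_eseriesr do rewrite big_ord0.
  by under [X in _ -> (1 <= X)%E]eq_eseriesr do rewrite expr0; apply => j;
    rewrite lexx ler01.
under eq_eseriesr do rewrite exprS mulrA.
apply: ih => [i|x x01]; first by rewrite mulr_ge0// mulr_ge0.
(* For fixed x, the factors of the first n coordinates go into the constant [c i]; the coordinate of
   index n becomes the variable t of integration, and its interval contributes at most 2 * l i. *)
pose c i : R := w i * \prod_(j < n) \1_(`[a i j - l i, a i j + l i]) (x j).
have c0 i : 0 <= c i.
  by rewrite mulr_ge0// prodr_ge0// => j _; rewrite indicE ler0n.
pose B i : set R := `[a i n - l i, a i n + l i]%classic.
have mB i : measurable (B i) by exact: measurable_itv.
pose D : set R := `[0, 1]%classic.
have mD : measurable D by exact: measurable_itv.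
have mcB i : measurable_fun D (EFin \o (fun t : R => c i * \1_(B i) t)).
  apply/measurable_EFinP; apply: measurable_funM; first exact: measurable_cst.
  exact: measurable_indic.
have cB0 i (t : R) : (0 <= (c i * \1_(B i) t)%:E)%E.
  by rewrite lee_fin mulr_ge0// indicE ler0n.
have -> : (1 = \int[@lebesgue_measure R]_(t in D) (cst 1 t))%E.
  rewrite integral_cst// mul1e; apply/esym.
  have := lebesgue_measure_itv (`[0, 1] : interval R).
  by rewrite /= lte_fin ltr01 -EFinB subr0.
apply: (@le_trans _ _ (\int[@lebesgue_measure R]_(t in D)
    \sum_(0 <= i <oo) (c i * \1_(B i) t)%:E)%E).
  apply: ge0_le_integral => //.
    apply: ge0_emeasurable_sum => [k t _ _|k _]; [exact: cB0|exact: mcB].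
  move=> t Dt.
  have t01 j : 0 <= (if j == n then t else x j) <= 1.
    by case: eqP => // _; move: Dt; rewrite /D/= in_itv.
  apply: (le_trans (hw _ t01)); rewrite le_eqVlt; apply/orP; left; apply/eqP.
  apply: eq_eseriesr => i _; rewrite big_ord_recr/= eqxx mulrA;
    congr (_ * _ * _)%:E.
  by apply: eq_bigr => j _; rewrite ltn_eqF.
rewrite integral_nneseries//.
apply: lee_nneseries => [i _ _|i _]; first exact: integral_ge0.
under eq_integral do rewrite EFinM.
have mB' : measurable_fun D (EFin \o (\1_(B i) : R -> R)).
  by apply/measurable_EFinP; exact: measurable_indic.
have := @ge0_integralZl_EFin _ _ R lebesgue_measure D mD _ _ mB' (c i) (c0 i).
rewrite /= => ->; last by move=> t _; rewrite lee_fin indicE ler0n.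
rewrite integral_indic//; last exact: mB.
rewrite mulrAC -/(c i) [leRHS]EFinM.
have ci : (0 <= (c i)%:E)%E by rewrite lee_fin.
apply: (lee_wpmul2l ci).
apply: (@le_trans _ _ (lebesgue_measure (B i))).
  by apply: measureIl => //; exact: mB.
rewrite /B lebesgue_measure_itv/= lte_fin; case: ifPn => _.
  by rewrite -EFinB lee_fin; lra.
by rewrite lee_fin mulr_ge0.
Qed.

(** A nonempty covering set lies in the box centered at one of its points with half-side its
    diameter. Boxes covering the unit cube have total volume at least 1, so the content at scale 1
    is at least 2 ^- n. *)
Lemma hausdorff_unit_cube_gt0 (R : realType) n :
  (0 < hausdorff_unnormalized n (@unit_cube R n))%E.
Proof.
have c0 : 0 < (2 ^+ n : R) by rewrite exprn_gt0.
apply: lt_le_trans _ (hausdorff_content_le_unnormalized n (@unit_cube R n)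
  (@ltr01 R)).
apply: (@lt_le_trans _ _ ((2 ^+ n)^-1)%:E); first by rewrite lte_fin invr_gt0.
apply: le_hausdorff_content => U CU hU.
have [ED hED] : exists D : nat -> R, forall i, U i !=set0 -> 0 <= D i /\ ediam
  (U i) = (D i)%:E.
  have /choice[D hD] : forall i, exists D : R, U i !=set0 -> 0 <= D /\ ediam (U
    i) = D%:E.
    move=> i; have [Ui|Ui] := pselect (U i !=set0); last by exists 0.
    by have [D D0 e] := ediam_fin Ui (hU i); exists D.
  by exists D.
(* The weight removes empty covering sets: for n = 0 the power (2 * l i) ^+ 0 is 1, whereas
   [ediam_pow] of the empty set is 0. *)
pose w i : R := (U i != set0)%:R.
pose l i : R := if U i == set0 then 0 else ED i.
(* The center is a chosen point of [U i]; coordinates of index n or more get the default 0. *)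
pose a i (j : nat) : R :=
  if insub j is Some k then (xget 0 (U i) : {ffun 'I_n -> R}) k else 0.
have w0 i : 0 <= w i by rewrite ler0n.
have l0 i : 0 <= l i by rewrite /l; case: ifPn => // /set0P/hED[].
have := weighted_box_cover (n := n) (a := a) w0 l0.
under eq_eseriesr => i _.
  have -> : (w i * (2 * l i) ^+ n)%:E = ((2 ^+ n)%:E * ediam_pow n (U i))%E.
    rewrite /w /l; case: eqP => [->|/eqP/set0P Ui];
      first by rewrite mul0r ediam_pow0 mule0.
    by have [_ e] := hED _ Ui; rewrite (ediam_powE n Ui e) mul1r exprMn EFinM.
  over.
rewrite nneseriesZl; last by move=> *; exact: ediam_pow_ge0.
move=> H; rewrite -[leLHS]mule1 lee_pdivrMl//; apply: H => x x01.
have : unit_cube [ffun j : 'I_n => x j] by move=> j; rewrite ffunE.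
move=> /CU[i _ Ui].
have Ui0 : U i !=set0 by eexists; exact: Ui.
have [_ ei] := hED _ Ui0.
rewrite (nneseriesD1 (n := i))//; last first.
  by move=> k _; rewrite lee_fin mulr_ge0// prodr_ge0// => j _;
    rewrite indicE ler0n.
rewrite -[leLHS]adde0; apply: leeD; last first.
  apply: nneseries_ge0 => k _ _.
  by rewrite lee_fin mulr_ge0// prodr_ge0// => j _; rewrite indicE ler0n.
have Ui1 : U i != set0 by apply/set0P.
rewrite /w Ui1 mul1r lee_fin big1// => j _.
rewrite indicE; have -> //: x j \in `[a i j - l i, a i j + l i]%classic.
rewrite inE /= in_itv/= -ler_distlC /l ifN//.
have xU : U i (xget 0 (U i)) by apply: xgetPex.
have := euclid_dist_le_ediam Ui xU; rewrite ei lee_fin; apply: le_trans.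
apply: le_trans (coord_le_euclid_dist _ _ j); rewrite ffunE /a.
by rewrite valK distrC.
Qed.

Definition cube_at (R : realType) (I : finType) (z : {ffun I -> R}) (s : R) :
    set {ffun I -> R} :=
  [set x | forall i, z i <= x i <= z i + s].

Lemma cube_at_image (R : realType) (I : finType) (z : {ffun I -> R}) (s : R) :
  0 < s ->
  cube_at z s = (fun x => [ffun i => s * x i + z i]) @` cube_at 0 1.
Proof.
move=> s0; apply/seteqP; split => [x zx|_ [x x01 <-] i].
  exists [ffun i => (x i - z i) / s].
    move=> i; rewrite !ffunE add0r divr_ge0 ?(ltW s0)//= ?subr_ge0.
      by rewrite ler_pdivrMr// mul1r lerBlDl; case/andP: (zx i).
    by case/andP: (zx i).
  by apply/ffunP => i; rewrite !ffunE mulrC divfK ?gt_eqF// subrK.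
have := x01 i; rewrite !ffunE add0r => /andP[x0 x1].
by rewrite lerDr mulr_ge0 ?(ltW s0)//= addrC lerD2l -[leRHS]mulr1 ler_wpM2l//
  ltW.
Qed.

Lemma hausdorff_cube_at (R : realType) (I : finType) n (z : {ffun I -> R})
    (s : R) :
  0 < s -> hausdorff_unnormalized n (cube_at z s) =
  ((s ^+ n)%:E * hausdorff_unnormalized n (@cube_at R I 0%R 1%R))%E.
Proof.
move=> s0; rewrite cube_at_image//;
  apply: hausdorff_unnormalized_similarity => // x y _ _.
rewrite -[in RHS](gtr0_norm s0) -euclid_distZ -[RHS](euclid_distD _ _ z).
by congr euclid_dist; apply/ffunP => i; rewrite !ffunE.
Qed.

(** The cells are closed, so x = m is caught by the last one. *)
Lemma nat_cell (R : realType) (m : nat) (x : R) : (0 < m)%N -> 0 <= x <= m%:R ->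
  exists k : 'I_m, k%:R <= x <= k%:R + 1.
Proof.
elim: m => // m ih _ /andP[x0 xm].
have [mx|xm'] := leP m%:R x.
  by exists ord_max; rewrite /= mx natr1.
have [m0|m0] := posnP m; first by rewrite m0 ltNge x0 in xm'.
have [|k hk] := ih m0; first by rewrite x0 ltW.
by exists (widen_ord (leqnSn m) k).
Qed.

(** Cutting the cube into m ^ n cubes of side 1 / m gives pieces of diameter at most sqrt n / m. The
    powers add up to sqrt n ^ n, a bound independent of m and hence of delta. *)
Lemma hausdorff_cube_lty (R : realType) (I : finType) n : #|I| = n ->
  (hausdorff_unnormalized n (@cube_at R I 0%R 1%R) < +oo)%E.
Proof.
move=> cI; apply: (@le_lt_trans _ _ (Num.sqrt n%:R ^+ n)%:E); last exact: ltry.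
apply: hausdorff_unnormalized_le => delta d0.
set q : R := Num.sqrt n%:R; have q0 : 0 <= q by exact: sqrtr_ge0.
pose m := (Num.truncn (q / delta)).+1.
have m0 : 0 < m%:R :> R by rewrite ltr0n.
have qm : q / m%:R <= delta.
  rewrite ler_pdivrMr// mulrC -ler_pdivrMr// ltW// truncnS_gt//.
have m_gt0 : (0 < m)%N by [].
clearbody m.
pose z (v : {ffun I -> 'I_m}) : {ffun I -> R} := [ffun i => (v i)%:R / m%:R].
have dz v x y : cube_at (z v) m%:R^-1 x -> cube_at (z v) m%:R^-1 y ->
    euclid_dist x y <= q / m%:R.
  move=> hx hy; rewrite /q -cI; apply: euclid_dist_le_sup;
    first by rewrite invr_ge0 ler0n.
  by move=> i; have := hx i; have := hy i; rewrite ler_norml; lra.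
apply: (@le_trans _ _ (hausdorff_content n delta
    (\bigcup_(v in [set v | predT v]) cube_at (z v) m%:R^-1))).
  apply: hausdorff_content_sub => x x01.
  have /choice[v hv] : forall i, exists k : 'I_m, k%:R <= x i * m%:R <= k%:R +
    1.
    move=> i; apply: nat_cell => //; have := x01 i;
      rewrite ffunE add0r => /andP[xi0 xi1].
    by rewrite mulr_ge0 ?(ltW m0)//= -[leRHS]mul1r ler_wpM2r ?(ltW m0).
  exists [ffun i => v i] => // i; rewrite !ffunE ler_pdivrMr//.
  by rewrite -[X in _ + X]mul1r -mulrDl ler_pdivlMr.
apply: (le_trans (hausdorff_content_bigcup _ _ _ _)).
apply: (@le_trans _ _ (\sum_(v : {ffun I -> 'I_m}) ((q / m%:R) ^+ n)%:E)%E).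
  apply: lee_sum => v _; apply: (le_trans (hausdorff_content_le_ediam_pow _ _)).
    by apply: ediam_le => x y zx zy;
      rewrite lee_fin (le_trans (dz v _ _ zx zy)).
  by apply: ediam_pow_le; [rewrite divr_ge0// ler0n|exact: dz].
rewrite sumEFin lee_fin sumr_const card_ffun card_ord cI -[leLHS]mulr_natl
  natrX.
by rewrite -exprMn mulrC divfK// gt_eqF.
Qed.

Lemma hausdorff_reindex (R : realType) (I J : finType) n (e : I -> J)
    (A : set {ffun J -> R}) : bijective e ->
  hausdorff_unnormalized n ((fun x : {ffun J -> R} => [ffun i => x (e i)]) @`
    A) =
  hausdorff_unnormalized n A.
Proof.
move=> be; rewrite (hausdorff_unnormalized_similarity _ ltr01) ?expr1n ?mul1e//
  => x y _ _.
rewrite mul1r; congr Num.sqrt; rewrite [RHS](reindex e).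
  by apply: eq_bigr => i _; rewrite !ffunE.
by apply: onW_bij.
Qed.

Lemma hausdorff_cube (R : realType) (I : finType) n : #|I| = n ->
  hausdorff_unnormalized n (@cube_at R I 0 1) =
  hausdorff_unnormalized n (@unit_cube R n).
Proof.
move=> cI; subst n.
rewrite -(hausdorff_reindex _ _ (enum_rank_bij I));
  congr hausdorff_unnormalized.
apply/seteqP; split => [x x01|_ [x x01 <-] i]; last by rewrite !ffunE add0r.
exists [ffun i => x (enum_val i)]; last first.
  by apply/ffunP => i; rewrite !ffunE enum_rankK.
by move=> i; rewrite ffunE; have := x01 (enum_val i); rewrite ffunE add0r.
Qed.

Definition cube_const (R : realType) n : R :=
  fine (hausdorff_unnormalized n (@unit_cube R n)).

Lemma cube_constE (R : realType) n :
  hausdorff_unnormalized n (@unit_cube R n) = (cube_const R n)%:E.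
Proof.
rewrite fineK// ge0_fin_numE ?hausdorff_unnormalized_ge0//.
by rewrite -(hausdorff_cube R (card_ord n)) hausdorff_cube_lty// card_ord.
Qed.

Lemma cube_const_gt0 (R : realType) n : 0 < cube_const R n.
Proof. by rewrite -lte_fin -cube_constE hausdorff_unit_cube_gt0. Qed.

Lemma hausdorff_fin (R : realType) (I : finType) n (A : set {ffun I -> R})
    (a : R) :
  hausdorff_unnormalized n A = a%:E -> hausdorff n A = (a / cube_const R n)%:E.
Proof.
by move=> e; rewrite /hausdorff e cube_constE inver gt_eqF ?cube_const_gt0//
  EFinM.
Qed.

(** * Letting a contraction ratio tend to 1 *)

Lemma bernoulli_inequality (R : realType) n (d : R) : 0 <= d <= 1 ->
  1 - n%:R * d <= (1 - d) ^+ n.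
Proof.
move=> /andP[d0 d1]; elim: n => [|n ih]; first by rewrite expr0 mul0r subr0.
rewrite exprS; apply: (@le_trans _ _ ((1 - d) * (1 - n%:R * d))).
  rewrite -natr1; have : 0 <= n%:R * d ^+ 2 :> R by rewrite mulr_ge0// sqr_ge0.
  by nra.
by rewrite ler_wpM2l// subr_ge0.
Qed.

Lemma le_of_contractions (R : realType) n (r s : R) : 0 <= r ->
  (forall t, 0 < t < 1 -> t ^+ n * r <= s) -> r <= s.
Proof.
move=> r0 h; apply/ler_addgt0Pr => e e0.
have nr0 : 0 < n%:R * r + 1 :> R by rewrite ltr_wpDl// mulr_ge0// ler0n.
(* With t = 1 - d, Bernoulli bounds the loss by n * d * r, which the second bound on d keeps below
   e. The bound 1/2 keeps t in ]0, 1[, and the added 1 makes the denominator positive. *)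
pose d : R := Num.min 2^-1 (e / (n%:R * r + 1)).
have d0 : 0 < d by rewrite lt_min divr_gt0// invr_gt0 ltr0n.
have d12 : d <= 2^-1 by rewrite ge_min lexx.
have de : d * (n%:R * r + 1) <= e by rewrite -ler_pdivlMr// ge_min lexx orbT.
have d1 : d < 1 by apply: (le_lt_trans d12); lra.
have hs := h (1 - d); have {}hs : (1 - d) ^+ n * r <= s by apply: hs; lra.
have : (1 - n%:R * d) * r <= (1 - d) ^+ n * r.
  by rewrite ler_wpM2r// bernoulli_inequality// (ltW d0) ltW.
by move: hs de; lra.
Qed.

Lemma lee_of_contractions (R : realType) n (r : R) (y : \bar R) : 0 <= r ->
  (forall t, 0 < t < 1 -> ((t ^+ n * r)%:E <= y)%E) -> (r%:E <= y)%E.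
Proof.
move=> r0; case: y => [s| |] h.
- by rewrite lee_fin; apply: (le_of_contractions (n := n) r0) => t /h;
  rewrite lee_fin.
- by rewrite leey.
- have h2 : (0 < (2^-1 : R) < 1) by apply/andP; split; lra.
  by have := h _ h2; rewrite leeNy_eq.
Qed.

(* A quantitative form of "convex with the ball of radius r around 0 inside". *)
Definition fat (R : realType) (I : finType) (r : R) (A : set {ffun I -> R}) :=
  forall (t : R) (a y : {ffun I -> R}), 0 < t < 1 -> A a ->
    (forall i, `|y i - t * a i| <= (1 - t) * r) -> A y.

Definition coord_bounded (R : realType) (I : finType) (M : nat)
    (A : set {ffun I -> R}) :=
  forall (x : {ffun I -> R}) i, A x -> `|x i| <= M%:R.

(** * Measuring a set by the grid cells that it contains *)

Section Grid.
Variables (R : realType) (m M : nat).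
Hypotheses (m_gt0 : (0 < m)%N) (M_gt0 : (0 < M)%N).

Let mR_gt0 : 0 < m%:R :> R. Proof. by rewrite ltr0n. Qed.

(* The cubes of the grid of mesh 1/m that subdivides [-M, M]^I. *)
Definition grid_corner (I : finType) (v : {ffun I -> 'I_(M.*2 * m)}) :
    {ffun I -> R} :=
  [ffun i => (v i)%:R / m%:R - M%:R].

Definition inner_cells (I : finType) (A : set {ffun I -> R}) :
    {set {ffun I -> 'I_(M.*2 * m)}} :=
  [set v | `[< cube_at (grid_corner v) m%:R^-1 `<=` A >]].

Definition grid_volume (I : finType) n (A : set {ffun I -> R}) : R :=
  #|inner_cells A|%:R / m%:R ^+ n.

(** Shrinking each inner cell to side t / m, with the same corner, leaves gaps of (1 - t) / m
    between distinct cells. Their measures then add up inside A, and t tends to 1. *)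
Lemma inner_cells_le (I : finType) n (A : set {ffun I -> R}) : #|I| = n ->
  ((grid_volume n A * cube_const R n)%:E <= hausdorff_unnormalized n A)%E.
Proof.
move=> cI; have c0 := cube_const_gt0 R n.
have v0 : 0 <= grid_volume n A by rewrite divr_ge0 ?exprn_ge0 ?ler0n.
apply: (lee_of_contractions (n := n)); first by rewrite mulr_ge0// ltW.
move=> t /andP[t0 t1].
have tm0 : 0 < t / m%:R by rewrite divr_gt0.
have sub : (\bigcup_(v in [set v | v \in inner_cells A])
    cube_at (grid_corner v) (t / m%:R)) `<=` A.
  move=> x [v /= + xv]; rewrite inE => /asboolP; apply => i.
  have /andP[-> h]/= := xv i; apply: (le_trans h).
  by rewrite lerD2l ler_piMl// ?invr_ge0 ?ler0n// ltW.
apply: le_trans (hausdorff_unnormalized_sub _ sub).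
have gap0 : 0 < (1 - t) / m%:R by rewrite divr_gt0// subr_gt0.
apply: le_trans (hausdorff_unnormalized_bigcup_separated (eta := (1 - t) /
  m%:R) _ gap0 _).
  under eq_bigr do rewrite hausdorff_cube_at// (hausdorff_cube R cI)
    cube_constE -EFinM.
  rewrite sumEFin lee_fin sumr_const /grid_volume -[leRHS]mulr_natl exprMn
    exprVn.
  by rewrite le_eqVlt; apply/orP; left; apply/eqP; ring.
move=> v w _ _ vw x y xv yw.
have [i vwi] : exists i, v i != w i.
  by apply/existsP; rewrite -negb_forall; apply: contra vw => /forallP e;
    apply/eqP/ffunP => i; exact/eqP.
apply: le_trans (coord_le_euclid_dist x y i).
move: (xv i) (yw i); rewrite !ffunE.
have [vwlt|] := ltnP (v i) (w i).
  have : ((v i)%:R + 1) / m%:R <= (w i)%:R / m%:R :> R.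
    by rewrite ler_pM2r ?invr_gt0// natr1 ler_nat.
  rewrite ler_normr !mulrDl !mul1r mulNr => *; apply/orP; right; lra.
rewrite leq_eqVlt eq_sym (negbTE (vwi : (v i : nat) != w i))/= => vwlt.
have : ((w i)%:R + 1) / m%:R <= (v i)%:R / m%:R :> R.
  by rewrite ler_pM2r ?invr_gt0// natr1 ler_nat.
rewrite ler_normr !mulrDl !mul1r mulNr => *; apply/orP; left; lra.
Qed.

(** The left-hand side is the measure of t A. A cell containing t a stays within 1 / m <= (1 - t) *
    r of it in each coordinate, so fatness puts the whole cell in A; thus the inner cells cover t
    A. *)
Lemma inner_cells_ge (I : finType) n (A : set {ffun I -> R}) (r t : R) :
  #|I| = n -> fat r A -> coord_bounded M A -> 0 < t < 1 -> m%:R^-1 <= (1 - t) *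
    r ->
  ((t ^+ n)%:E * hausdorff_unnormalized n A <=
   (grid_volume n A * cube_const R n)%:E)%E.
Proof.
move=> cI fA bA t01 hr; have /andP[t0 t1] := t01; have c0 := cube_const_gt0 R n.
have minv0 : 0 < m%:R^-1 :> R by rewrite invr_gt0.
rewrite -(@hausdorff_unnormalized_similarity R I I n A (fun x => [ffun i => t *
  x i]) t t0); last first.
  by move=> x y _ _; rewrite euclid_distZ gtr0_norm.
apply: (@le_trans _ _ (hausdorff_unnormalized n
    (\bigcup_(v in [set v | v \in inner_cells A])
      cube_at (grid_corner v) m%:R^-1))); last first.
  apply: (le_trans (hausdorff_unnormalized_bigcup _ _ _)).
  under eq_bigr do rewrite hausdorff_cube_at// (hausdorff_cube R cI)
    cube_constE -EFinM.
  rewrite sumEFin lee_fin sumr_const /grid_volume -[leLHS]mulr_natl exprVn.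
  by rewrite mulrA.
apply: hausdorff_unnormalized_sub => _ [a Aa <-].
have /choice[v hv] : forall i, exists k : 'I_(M.*2 * m),
    k%:R <= (t * a i + M%:R) * m%:R <= k%:R + 1.
  move=> i; apply: nat_cell; first by rewrite muln_gt0 double_gt0 M_gt0.
  have /andP[h1 h2] : - M%:R <= t * a i <= M%:R.
    rewrite -ler_norml normrM (gtr0_norm t0).
    by apply: le_trans (bA a i Aa); rewrite ler_piMl// ltW.
  rewrite mulr_ge0 ?(ltW mR_gt0)//=; last by lra.
  by rewrite natrM ler_wpM2r ?(ltW mR_gt0)// -mul2n natrM; lra.
have hcell : cube_at (grid_corner [ffun i => v i]) m%:R^-1 [ffun i => t * a i].
  move=> i; rewrite !ffunE lerBlDr ler_pdivrMr//.
  have /andP[-> h]/= := hv i.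
  rewrite addrAC -[X in _ + X - _]mul1r -mulrDl lerBrDr ler_pdivlMr//.
exists [ffun i => v i] => //=; rewrite inE; apply/asboolP => y hy.
apply: (fA t a y) => // i; apply: le_trans hr.
by move: (hy i) (hcell i); rewrite !ffunE ler_norml; lra.
Qed.

End Grid.

Lemma mesh_exists (R : realType) (t r : R) : t < 1 -> 0 < r ->
  exists2 m : nat, (0 < m)%N & m%:R^-1 <= (1 - t) * r.
Proof.
move=> t1 r0; have h : 0 < (1 - t) * r by rewrite mulr_gt0// subr_gt0.
exists (Num.truncn ((1 - t) * r)^-1).+1 => //.
by rewrite invf_ple ?posrE ?ltr0n// ltW// truncnS_gt.
Qed.

(** At t = 1/2, [inner_cells_ge] bounds a positive multiple of the measure by a finite cell
    count. *)
Lemma fat_hausdorff_fin (R : realType) (I : finType) n M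
    (A : set {ffun I -> R}) (r : R) :
  #|I| = n -> (0 < M)%N -> 0 < r -> fat r A -> coord_bounded M A ->
  hausdorff_unnormalized n A \is a fin_num.
Proof.
move=> cI M0 r0 fA bA; rewrite ge0_fin_numE ?hausdorff_unnormalized_ge0//.
have t01 : (0 < (2^-1 : R) < 1) by apply/andP; split; lra.
have /andP[t0 t1] := t01; have [m m0 hm] := mesh_exists t1 r0.
have tn0 : 0 < 2^-1 ^+ n :> R by rewrite exprn_gt0.
have := inner_cells_ge m0 M0 cI fA bA t01 hm; rewrite muleC -lee_pdivlMr//.
by move=> /le_lt_trans; apply; rewrite -EFinM ltry.
Qed.

(** * Product sets, as sets of functions on the disjoint union of the index types *)

Definition set_prod (R : realType) (K : finType) (J : K -> finType)
    (A : forall k, set {ffun J k -> R}) : set {ffun {k : K & J k} -> R} :=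
  [set x | forall k, A k [ffun j => x (Tagged J j)]].

Section Product.
Variables (R : realType) (K : finType) (J : K -> finType).
Variable A : forall k, set {ffun J k -> R}.

(** The margin in [fat] is measured coordinate by coordinate, so the same r serves for the
    product. *)
Lemma fat_set_prod (r : R) : (forall k, fat r (@A k)) -> fat r (set_prod A).
Proof.
move=> fA t a y t01 Aa hy k; apply: (fA k t _ _ t01 (Aa k)) => j.
by rewrite !ffunE.
Qed.

Lemma coord_bounded_set_prod M :
  (forall k, coord_bounded M (@A k)) -> coord_bounded M (set_prod A).
Proof.
by move=> bA x [k j] Ax; have := bA k _ j (Ax k); rewrite ffunE.
Qed.

(** Currying identifies a cell of the product with a family of cells. As cells are nonempty, the
    product cell lies in the product set exactly when every factor cell lies in its factor. *)
Lemma card_inner_cells_set_prod m M : (0 < m)%N ->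
  #|inner_cells m M (set_prod A)| = (\prod_k #|inner_cells m M (@A k)|)%N.
Proof.
move=> m0; set L := (M.*2 * m)%N.
pose cur (v : {ffun {k : K & J k} -> 'I_L}) :
    {dffun forall k, {ffun J k -> 'I_L}} :=
  [ffun k => [ffun j => v (Tagged J j)]].
pose unc (w : {dffun forall k, {ffun J k -> 'I_L}}) :
    {ffun {k : K & J k} -> 'I_L} :=
  [ffun t => w (tag t) (tagged t)].
have cu : cancel cur unc.
  by move=> v; apply/ffunP => -[k j]; rewrite !ffunE.
have uc : cancel unc cur.
  by move=> w; apply/ffunP => k; apply/ffunP => j; rewrite !ffunE.
rewrite -cardsXn -(on_card_preimset (f := cur)); last by apply: onW_bij;
  exists unc.
apply: eq_card => v; rewrite !inE; apply/asboolP/forallP => [h k|h x hx k].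
  rewrite inE; apply/asboolP => y hy.
  (* To test the factor k alone, y is completed by the corners of the cells in the other factors,
     giving a point of the product cell. *)
  pose w : forall k, {ffun J k -> R} :=
    eqtype.dfwith (fun k => grid_corner R (cur v k)) y.
  have : set_prod A [ffun t => w (tag t) (tagged t)].
    apply: h => -[k' j]; rewrite !ffunE /=.
    have [k'k|k'k] := eqVneq k' k; last first.
      by rewrite /w dfwith_out 1?eq_sym// !ffunE lexx lerDl invr_ge0 ler0n.
    by move: j; rewrite k'k => j; rewrite /w dfwith_in; have := hy j;
      rewrite !ffunE.
  move=> /(_ k); congr A; apply/ffunP => j; rewrite !ffunE /=.
  by rewrite /w dfwith_in.
have := h k; rewrite inE => /asboolP; apply => j.
by have := hx (Tagged J j); rewrite !ffunE.
Qed.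

(** Grid volumes are multiplicative, and each normalized measure lies between its grid volume and t
    to the minus dimension times that volume. The common M and r allow one mesh for all factors. *)
Lemma hausdorff_set_prod (n : K -> nat) M (r : R) :
  (forall k, #|J k| = n k) -> (0 < M)%N -> 0 < r ->
  (forall k, fat r (@A k)) -> (forall k, coord_bounded M (@A k)) ->
  (hausdorff (\sum_k n k)%N (set_prod A) = \prod_k hausdorff (n k) (@A k))%E.
Proof.
move=> cJ M0 r0 fA bA; set N := (\sum_k n k)%N.
have cT : #|{: {k : K & J k}}| = N.
  by rewrite card_tagged sumnE big_map big_enum; apply: eq_bigr => k _.
have fP := fat_set_prod fA; have bP := coord_bounded_set_prod bA.
pose a k := fine (hausdorff_unnormalized (n k) (@A k)).
have ha k : hausdorff_unnormalized (n k) (@A k) = (a k)%:E.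
  by rewrite fineK// (fat_hausdorff_fin (cJ k) M0 r0 (fA k) (bA k)).
pose b := fine (hausdorff_unnormalized N (set_prod A)).
have hb : hausdorff_unnormalized N (set_prod A) = b%:E.
  by rewrite fineK// (fat_hausdorff_fin cT M0 r0 fP bP).
rewrite (hausdorff_fin hb); under eq_bigr do rewrite (hausdorff_fin (ha _)).
rewrite prodEFin; congr EFin.
have c0 := cube_const_gt0 R.
have a0 k : 0 <= a k / cube_const R (n k).
  by rewrite divr_ge0 ?(ltW (c0 _))// fine_ge0// hausdorff_unnormalized_ge0.
have b0 : 0 <= b / cube_const R N.
  by rewrite divr_ge0 ?(ltW (c0 _))// fine_ge0// hausdorff_unnormalized_ge0.
have vP m : (0 < m)%N ->
    grid_volume m M N (set_prod A) = \prod_k grid_volume m M (n k) (@A k).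
  move=> m0; rewrite /grid_volume card_inner_cells_set_prod// natr_prod.
  by rewrite big_split/= prodfV -expr_sum.
have v0 m (I : finType) p (B : set {ffun I -> R}) : 0 <= grid_volume m M p B.
  by rewrite divr_ge0 ?exprn_ge0 ?ler0n.
have ub m k : (0 < m)%N -> grid_volume m M (n k) (@A k) <= a k / cube_const R
  (n k).
  move=> m0; rewrite ler_pdivlMr// -lee_fin -ha.
  exact: inner_cells_le.
have ubP m : (0 < m)%N -> grid_volume m M N (set_prod A) <= b / cube_const R N.
  move=> m0; rewrite ler_pdivlMr// -lee_fin -hb.
  exact: inner_cells_le.
apply/eqP; rewrite eq_le; apply/andP; split.
- apply: (le_of_contractions (n := N)) => // t t01.
  have /andP[t0 t1] := t01; have [m m0 hm] := mesh_exists t1 r0.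
  apply: (@le_trans _ _ (grid_volume m M N (set_prod A))).
    rewrite mulrA ler_pdivrMr// -lee_fin EFinM -hb.
    exact: (inner_cells_ge m0 M0 cT fP bP t01 hm).
  by rewrite vP//; apply: ler_prod => k _; rewrite v0 ub.
- apply: (le_of_contractions (n := N)) => [|t t01]; first exact: prodr_ge0.
  have /andP[t0 t1] := t01; have [m m0 hm] := mesh_exists t1 r0.
  apply: le_trans (ubP m m0).
  (* The factor t ^+ N is shared out, one power t ^+ n k for each k. *)
  rewrite vP// /N expr_sum -big_split/=; apply: ler_prod => k _.
  rewrite mulr_ge0 ?exprn_ge0 ?(ltW t0)//= mulrA ler_pdivrMr// -lee_fin EFinM
    -ha.
  exact: (inner_cells_ge m0 M0 (cJ k) (fA k) (bA k) t01 hm).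
Qed.

End Product.

(** * Sets lying in a coordinate hyperplane *)

(* The translates of A in the direction i by multiples of 1/m are separated
   and all lie in one bounded box, so m * H(A) stays bounded. *)
Lemma hausdorff_flat (R : realType) (I : finType) n M (A : set {ffun I -> R})
  (i : I) :
  #|I| = n -> coord_bounded M A -> (forall x, A x -> x i = 0) ->
  hausdorff_unnormalized n A = 0%E.
Proof.
move=> cI bA Ai0.
(* This is the box [-M, M + 1] in each coordinate: the shifts j / m are below 1. *)
pose B := cube_at [ffun=> - M%:R] (M%:R + M%:R + 1) : set {ffun I -> R}.
pose b := fine (hausdorff_unnormalized n B).
have s0 : 0 < M%:R + M%:R + 1 :> R by rewrite ltr_wpDl// addr_ge0// ler0n.
have hB : hausdorff_unnormalized n B = b%:E.
  by rewrite fineK// /B hausdorff_cube_at// (hausdorff_cube R cI) cube_constE.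
pose shift (m : nat) (j : 'I_m) (x : {ffun I -> R}) : {ffun I -> R} :=
  [ffun k => x k + [ffun k => if k == i then j%:R / m%:R else 0] k].
have key (m : nat) : (0 < m)%N -> (m%:R%:E * hausdorff_unnormalized n A <=
  b%:E)%E.
  move=> m0; have mR0 : 0 < m%:R^-1 :> R by rewrite invr_gt0 ltr0n.
  rewrite -hB; apply: (@le_trans _ _ (hausdorff_unnormalized n
      (\bigcup_(j in [set j | predT j]) (@shift m j @` A)))).
    apply: le_trans (hausdorff_unnormalized_bigcup_separated (eta := m%:R^-1) _
      mR0 _).
      under eq_bigr => j _.
        rewrite (hausdorff_unnormalized_similarity _ ltr01) ?expr1n ?mul1e;
          last first.
          by move=> x y _ _; rewrite euclid_distD mul1r.
        over.
      by rewrite sumr_const card_ord -[leRHS]mule_natl.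
    move=> j k _ _ jk _ _ [x Ax <-] [y Ay <-].
    apply: le_trans (coord_le_euclid_dist _ _ i).
    rewrite !ffunE eqxx (Ai0 _ Ax) (Ai0 _ Ay) !add0r -mulrBl normrM.
    rewrite [`|_^-1|]gtr0_norm// ler_peMl ?(ltW mR0)//.
    move: jk; wlog jk : j k / (j < k)%N => [H|_].
      move=> jk; have [lt|kj|/val_inj e] := ltngtP j k;
        [exact: (H _ _ lt jk)| |by rewrite e eqxx in jk].
      by rewrite distrC H// eq_sym.
    rewrite distrC ger0_norm ?subr_ge0 ?ler_nat ?(ltnW jk)//.
    by rewrite lerBrDr addrC natr1 ler_nat.
  apply: hausdorff_unnormalized_sub => _ [j _ [x Ax <-]] k.
  have := bA x k Ax; rewrite ler_norml /shift !ffunE => /andP[h1 h2].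
  have : 0 <= (if k == i then j%:R / m%:R else 0 : R) <= 1.
    case: ifP => _; last by rewrite lexx ler01.
    by rewrite divr_ge0 ?ler0n//= ler_pdivrMr ?ltr0n// mul1r ler_nat ltnW.
  move: (if _ then _ else _) => u; lra.
(* The case m = 1 gives finiteness. A value a > 0 would then contradict [key] for an integer m > b /
   a. *)
have := key 1%N isT; rewrite mul1e => h1.
have fA : hausdorff_unnormalized n A \is a fin_num.
  by rewrite ge0_fin_numE ?hausdorff_unnormalized_ge0// (le_lt_trans h1)// ltry.
apply/eqP; rewrite eq_le hausdorff_unnormalized_ge0 andbT leNgt;
  apply/negP => hA.
move: key fA hA; case: hausdorff_unnormalized => // a key _;
  rewrite lte_fin => a0.
have := key (Num.truncn (b / a)).+1 isT.
rewrite -EFinM lee_fin -ler_pdivlMr// leNgt => /negP; apply.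
exact: truncnS_gt.
Qed.

(** * The simplex as an isometric copy of a set of full dimension *)

Section SimplexModel.
Variables (R : realType) (n : nat).

(** The length of the all-ones vector of R^(n+1). The relation n = c ^+ 2 - 1 turns the identities
    below into rational identities in c. *)
Let c : R := Num.sqrt n.+1%:R.

Let c_gt0 : 0 < c. Proof. by rewrite sqrtr_gt0 ltr0n. Qed.

Let c_sqr : c ^+ 2 = n%:R + 1. Proof. by rewrite sqr_sqrtr ?ler0n// -natr1. Qed.

Let c_ge1 : 1 <= c.
Proof. by rewrite -[leLHS]sqrtr1 ler_sqrt ?ltr0n// ler1n. Qed.

(* A linear isometry from R^n onto the hyperplane of R^(n+1) where the sum of
   the coordinates vanishes. *)
Definition hyperplane_map (x : {ffun 'I_n -> R}) (j : 'I_n.+1) : R :=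
  if unlift ord0 j is Some i then x i - (\sum_k x k) / (c * (c + 1))
  else - (\sum_k x k) / c.

(** The origin is sent to the barycenter of the simplex, which gives the domain a margin around 0
    when q > 0. *)
Definition simplex_chart (q : R) (x : {ffun 'I_n -> R}) : {ffun 'I_n.+1 -> R} :=
  [ffun j => q / n.+1%:R + hyperplane_map x j].

Definition simplex_domain (q : R) : set {ffun 'I_n -> R} :=
  [set x | forall j, 0 <= simplex_chart q x j].

Lemma hyperplane_map0 x : hyperplane_map x ord0 = - (\sum_k x k) / c.
Proof. by rewrite /hyperplane_map unlift_none. Qed.

Lemma hyperplane_map_lift x i :
  hyperplane_map x (lift ord0 i) = x i - (\sum_k x k) / (c * (c + 1)).
Proof. by rewrite /hyperplane_map liftK. Qed.

Lemma sum_simplex_chart q x : \sum_j simplex_chart q x j = q.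
Proof.
under eq_bigr do rewrite ffunE.
rewrite big_split/= sumr_const card_ord -[X in X + _]mulr_natr divfK
  ?pnatr_eq0//.
rewrite big_ord_recl hyperplane_map0 (eq_bigr _ (fun i _ => hyperplane_map_lift
  x i)).
rewrite big_split/= sumr_const card_ord -[_ *+ n]mulr_natl.
have -> : n%:R = c ^+ 2 - 1 by rewrite c_sqr addrK.
set s := \sum_k x k; field.
by rewrite !gt_eqF// addr_gt0.
Qed.

Lemma simplex_chart_dist q x y :
  euclid_dist (simplex_chart q x) (simplex_chart q y) = euclid_dist x y.
Proof.
congr Num.sqrt; rewrite big_ord_recl !ffunE !hyperplane_map0.
set s := \sum_k x k; set u := \sum_k y k.
under eq_bigr do rewrite !ffunE !hyperplane_map_lift -/s -/u.
(* All the differences x i - y i are shifted by the same D. The terms in (s - u) ^+ 2 so produced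
   cancel against the coordinate 0. *)
pose D := (s - u) / (c * (c + 1)).
have -> : \sum_(i < n) (q / n.+1%:R + (x i - s / (c * (c + 1))) -
    (q / n.+1%:R + (y i - u / (c * (c + 1))))) ^+ 2 =
    \sum_(i < n) ((x i - y i) ^+ 2 - (2 * D) * (x i - y i) + D ^+ 2).
  by apply: eq_bigr => i _; rewrite /D; ring.
rewrite !big_split/= sumr_const card_ord -[_ *+ n]mulr_natl sumrN -mulr_sumr
  sumrB -/s -/u.
have -> : n%:R = c ^+ 2 - 1 by rewrite c_sqr addrK.
rewrite /D; set S := \sum_(i < n) _ ^+ 2; field.
by rewrite !gt_eqF// ?addr_gt0// ltr0n.
Qed.

Lemma simplex_chart_image q : simplex_chart q @` simplex_domain q = simplex q.
Proof.
apply/seteqP; split => [_ [x Ax <-]|y [y0 sy]].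
  by split => //; exact: sum_simplex_chart.
(* Coordinate 0 of the chart forces the sum of x to be -c * (y ord0 - q / (n + 1)); substituting
   this in the other coordinates and solving gives x. *)
pose x : {ffun 'I_n -> R} :=
  [ffun i => y (lift ord0 i) - q / n.+1%:R - (y ord0 - q / n.+1%:R) / (c + 1)].
have n0 : n%:R = c ^+ 2 - 1 by rewrite c_sqr addrK.
have sx : \sum_k x k = - c * (y ord0 - q / n.+1%:R).
  under eq_bigr do rewrite ffunE.
  rewrite !sumrB !sumr_const card_ord -(mulr_natl (q / _)) -(mulr_natl (_ / (c
    + 1))).
  move: sy; rewrite big_ord_recl => <-; rewrite -natr1 n0.
  set S := \sum_(i < n) _; field.
  by rewrite ?subrK !gt_eqF// ?addr_gt0// ?exprn_gt0.
have xy : simplex_chart q x = y.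
  apply/ffunP => j; rewrite ffunE; case: (unliftP ord0 j) => [i ->|->].
    rewrite hyperplane_map_lift sx ffunE; field.
    by rewrite !gt_eqF// ?addr_gt0// ltr0n.
  rewrite hyperplane_map0 sx; field.
  by rewrite !gt_eqF// ltr0n.
by exists x => // j; rewrite xy.
Qed.

Lemma hausdorff_simplex m q :
  hausdorff_unnormalized m (@simplex R n q) =
  hausdorff_unnormalized m (simplex_domain q).
Proof.
rewrite -simplex_chart_image (hausdorff_unnormalized_similarity _ ltr01)
  ?expr1n ?mul1e//.
by move=> x y _ _; rewrite simplex_chart_dist mul1r.
Qed.

(** The origin is in the domain, the chart is an isometry, and two points of the simplex differ by
    at most q in each of the n + 1 coordinates. *)
Lemma simplex_domain_bounded q x i : 0 <= q -> simplex_domain q x ->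
  `|x i| <= c * q.
Proof.
move=> q0 Ax; have := coord_le_euclid_dist x 0 i; rewrite ffunE subr0 => h.
apply: (le_trans h);
  rewrite -(simplex_chart_dist q) /c -[in n.+1%:R](card_ord n.+1).
have le_q (z : {ffun 'I_n -> R}) j : simplex_domain q z -> simplex_chart q z j
  <= q.
  move=> Az; rewrite -[leRHS](sum_simplex_chart q z) (bigD1 j)//= lerDl.
  by apply: sumr_ge0 => k _; exact: Az.
have A0 : simplex_domain q 0.
  move=> j; rewrite ffunE /hyperplane_map big1 => [|k _]; last by rewrite ffunE.
  by case: unliftP => [k _|_];
    rewrite ?ffunE ?oppr0 ?mul0r ?subr0 addr0 divr_ge0.
apply: euclid_dist_le_sup => // j; rewrite ler_norml.
by have := le_q _ j A0; have := le_q _ j Ax; have := A0 j; have := Ax j; lra.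
Qed.

Lemma coord_bounded_simplex_domain q : 0 <= q <= 1 ->
  coord_bounded n.+1 (simplex_domain q).
Proof.
move=> /andP[q0 q1] x i Ax; apply: (le_trans (simplex_domain_bounded i q0 Ax)).
apply: (@le_trans _ _ (c * c));
  first by rewrite ler_wpM2l ?(ltW c_gt0)// (le_trans q1).
by rewrite -expr2 c_sqr natr1.
Qed.

(** The coordinate sum moves by at most n * e and is divided by c or c * (c + 1), both at least 1;
    the coordinate itself adds at most e. *)
Lemma hyperplane_map_close (a y : {ffun 'I_n -> R}) (t e : R) j :
  0 <= e -> (forall i, `|y i - t * a i| <= e) ->
  `|hyperplane_map y j - t * hyperplane_map a j| <= n.+1%:R * e.
Proof.
move=> e0 h; set s := \sum_k y k; set u := \sum_k a k.
have hs : `|s - t * u| <= n%:R * e.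
  rewrite /s /u mulr_sumr -sumrB; apply: (le_trans (ler_norm_sum _ _ _)).
  by rewrite mulr_natl -[n in _ *+ n]card_ord -sumr_const; apply: ler_sum.
have ne0 : 0 <= n%:R * e by rewrite mulr_ge0.
have scale b : 1 <= b -> `|(s - t * u) / b| <= n%:R * e.
  move=> b1; have b0 : 0 < b by apply: lt_le_trans b1.
  rewrite normrM normfV (gtr0_norm b0) ler_pdivrMr//.
  by apply: (le_trans hs); rewrite ler_peMr.
rewrite -natr1 mulrDl mul1r; case: (unliftP ord0 j) => [i ->|->].
  rewrite !hyperplane_map_lift -/s -/u.
  have -> : y i - s / (c * (c + 1)) - t * (a i - u / (c * (c + 1))) =
    (y i - t * a i) - (s - t * u) / (c * (c + 1)) by ring.
  apply: (le_trans (ler_normB _ _)); rewrite addrC lerD//; apply: scale.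
  by rewrite -[leLHS]mulr1 ler_pM// lerDr ltW.
rewrite !hyperplane_map0 -/s -/u.
have -> : - s / c - t * (- u / c) = - ((s - t * u) / c) by ring.
by rewrite normrN; apply: (le_trans (scale _ c_ge1)); rewrite lerDl.
Qed.

Lemma fat_simplex_domain q : 0 <= q -> (q = 0 -> n = 0%N) ->
  exists2 r, 0 < r & fat r (simplex_domain q).
Proof.
rewrite le_eqVlt => /orP[/eqP <- /(_ erefl) n0|q0 _].
  (* For q = 0 the dimension is 0, so there is no coordinate to control and any margin works. *)
  have noI (i : 'I_n) : False.
    by have := leq_ltn_trans (leq0n i) (ltn_ord i); rewrite n0.
  exists 1 => // t a y _ _ _ j; rewrite ffunE /hyperplane_map big1 => [|k].
    rewrite mul0r add0r oppr0 !mul0r; case: unliftP => [i _|//].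
    by case: (noI i).
  by case: (noI k).
have nn0 : 0 < n.+1%:R :> R by rewrite ltr0n.
(* By [hyperplane_map_close], this margin costs at most (1 - t) * q / (n + 1) per chart coordinate,
   exactly what separates q / (n + 1) from its multiple by t. *)
exists (q / n.+1%:R / n.+1%:R); first by rewrite !divr_gt0.
move=> t a y /andP[t0 t1] Aa h j.
have e0 : 0 <= (1 - t) * (q / n.+1%:R / n.+1%:R).
  by rewrite mulr_ge0 ?subr_ge0 ?(ltW t1)// !divr_ge0// ltW.
have := hyperplane_map_close j e0 h.
rewrite mulrCA [n.+1%:R * _]mulrC divfK ?gt_eqF// ler_norml ffunE => /andP[hy
  _].
have := Aa j; rewrite ffunE => /(ler_wpM2l (ltW t0)).
move: hy; rewrite mulr0.
by move: (q / _) (hyperplane_map y j) (hyperplane_map a j) => u Y A; nra.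
Qed.

End SimplexModel.

Arguments simplex_domain {R} n q.

(** * From prescribed fiber sums to products of simplices *)

Lemma eq_hausdorff (R : realType) (I J : finType) m (A : set {ffun I -> R})
    (B : set {ffun J -> R}) :
  hausdorff_unnormalized m A = hausdorff_unnormalized m B ->
  hausdorff m A = hausdorff m B.
Proof. by rewrite /hausdorff => ->. Qed.

(** Squared distances add up over the factors, so isometries applied factor by factor form an
    isometry of the product. *)
Lemma set_prod_image (R : realType) (K : finType) (J J' : K -> finType)
    (f : forall k, {ffun J k -> R} -> {ffun J' k -> R})
    (A : forall k, set {ffun J k -> R}) m :
  (forall k x y, euclid_dist (f k x) (f k y) = euclid_dist x y) ->
  hausdorff_unnormalized m (set_prod (fun k => f k @` A k)) =
  hausdorff_unnormalized m (set_prod A).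
Proof.
move=> fd.
pose F (x : {ffun {k : K & J k} -> R}) : {ffun {k : K & J' k} -> R} :=
  [ffun t => f (tag t) [ffun j => x (Tagged J j)] (tagged t)].
have Fr x k : [ffun j => F x (Tagged J' j)] = f k [ffun j => x (Tagged J j)].
  by apply/ffunP => j; rewrite !ffunE.
have -> : set_prod (fun k => f k @` A k) = F @` set_prod A.
  apply/seteqP; split => [y hy|_ [x Ax <-] k]; last first.
    by rewrite Fr; exists [ffun j => x (Tagged J j)].
  pose P k : set {ffun J k -> R} := [set x | A k x /\ f k x = [ffun j => y
    (Tagged J' j)]].
  have hP k : P k (xget 0 (P k)) by apply: xgetPex; have [x Ax fx] := hy k;
    exists x.
  pose x : {ffun {k : K & J k} -> R} := [ffun t => xget 0 (P (tag t)) (tagged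
    t)].
  have xk k : [ffun j => x (Tagged J j)] = xget 0 (P k).
    by apply/ffunP => j; rewrite !ffunE.
  exists x; first by move=> k; rewrite xk; have [] := hP k.
  apply/ffunP => -[k j]; rewrite ffunE /= xk.
  by have [_ ->] := hP k; rewrite ffunE.
rewrite (hausdorff_unnormalized_similarity _ ltr01) ?expr1n ?mul1e// => x y _ _.
rewrite mul1r; congr Num.sqrt.
have sigma (I : K -> finType) (g : {k : K & I k} -> R) :
    \sum_t g t = \sum_k \sum_(j : I k) g (Tagged I j).
  by rewrite sig_big_dep; apply: eq_bigr => -[].
have sqr (I : finType) (u v : {ffun I -> R}) :
    euclid_dist u v ^+ 2 = \sum_i (u i - v i) ^+ 2.
  by rewrite sqr_sqrtr// sumr_ge0// => i _; exact: sqr_ge0.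
rewrite !sigma; apply: eq_bigr => k _.
have := congr1 (fun z : R => z ^+ 2)
  (fd k [ffun j => x (Tagged J j)] [ffun j => y (Tagged J j)]).
rewrite /= !sqr => e; transitivity (\sum_j (f k [ffun j => x (Tagged J j)] j -
    f k [ffun j => y (Tagged J j)] j) ^+ 2).
  by apply: eq_bigr => j _; rewrite !ffunE.
by rewrite e; apply: eq_bigr => j _; rewrite !ffunE.
Qed.

Section Fibers.
Variables (R : realType) (T K : finType) (S : T -> K) (n : K -> nat).
Hypothesis card_fiber : forall k, #|[set b | S b == k]%SET| = (n k).+1.

(** Numbers T fiber by fiber, so that functions on T become points of a product of spaces R^(n k +
    1). *)
Definition fiber_param (t : {k : K & 'I_(n k).+1}) : T :=
  enum_val (cast_ord (esym (card_fiber (tag t))) (tagged t)).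

Lemma fiber_paramK t : S (fiber_param t) = tag t.
Proof.
by have := enum_valP (cast_ord (esym (card_fiber (tag t))) (tagged t));
  rewrite inE => /eqP.
Qed.

Lemma fiber_param_bij : bijective fiber_param.
Proof.
have inj : injective fiber_param.
  move=> [k j] [k' j'] e; have := congr1 S e; rewrite !fiber_paramK /= => kk'.
  by move: j' e; rewrite -kk' => j' /enum_val_inj/cast_ord_inj /= ->.
have surj b : exists t, fiber_param t = b.
  have hb : b \in [set b' | S b' == S b]%SET by rewrite inE.
  exists (Tagged (fun k => 'I_(n k).+1) (cast_ord (card_fiber (S b))
    (enum_rank_in hb b))).
  by rewrite /fiber_param /= cast_ordK; exact: enum_rankK_in.
have /choice[g gK] := surj.
by exists g => // t; apply: inj; rewrite gK.
Qed.

Lemma sum_fiber_param (f : T -> R) k :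
  \sum_(b | S b == k) f b = \sum_j f (fiber_param (Tagged (fun k => 'I_(n
    k).+1) (j : 'I_(n k).+1))).
Proof.
rewrite (eq_bigl (fun b => b \in [set b | S b == k]%SET)); last by move=> b;
  rewrite inE.
rewrite big_enum_val (reindex (cast_ord (esym (card_fiber k)))) //=.
by apply: onW_bij; exists (cast_ord (card_fiber k));
  [exact: cast_ordKV|exact: cast_ordK].
Qed.

Definition fiber_sums (p : K -> R) : set {ffun T -> R} :=
  [set f | (forall b, 0 <= f b) /\ forall k, \sum_(b | S b == k) f b = p k].

(** After reindexing by [fiber_param], the conditions decouple into one simplex per fiber, and each
    simplex is the chart image of its domain. *)
Lemma hausdorff_fiber_sums m (p : K -> R) :
  hausdorff_unnormalized m (fiber_sums p) =
  hausdorff_unnormalized m (set_prod (fun k => simplex_domain (n k) (p k))).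
Proof.
rewrite -(set_prod_image _ _ (fun k => @simplex_chart_dist R (n k) (p k))).
rewrite -(hausdorff_reindex _ _ fiber_param_bij); congr hausdorff_unnormalized.
apply/seteqP; split => [_ [f [f0 sf] <-] k|y hy].
  rewrite simplex_chart_image; split => [j|]; first by rewrite !ffunE.
  by rewrite -sf sum_fiber_param; apply: eq_bigr => j _; rewrite !ffunE.
have [g gK Kg] := fiber_param_bij.
exists [ffun b => y (g b)]; last by apply/ffunP => t; rewrite !ffunE gK.
have yk k : simplex (p k) [ffun j : 'I_(n k).+1 => y (Tagged (fun k => 'I_(n
  k).+1) j)].
  by have := hy k; rewrite simplex_chart_image.
split => [b|k].
  rewrite ffunE; case: (g b) => k j; have [+ _] := yk k.
  by move=> /(_ j); rewrite ffunE.
rewrite sum_fiber_param; have [_ <-] := yk k.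
by apply: eq_bigr => j _; rewrite !ffunE gK.
Qed.

Lemma hausdorff_fiber_sums_prod (p : K -> R) : (forall k, 0 <= p k <= 1) ->
  (hausdorff (\sum_k n k)%N (fiber_sums p) =
   \prod_k hausdorff (n k) (@simplex R (n k) (p k)))%E.
Proof.
move=> p01.
rewrite (eq_hausdorff (hausdorff_fiber_sums _ p)).
under [RHS]eq_bigr do rewrite (eq_hausdorff (hausdorff_simplex _ _ _)).
pose M := (\max_k (n k).+1)%N.
have bA k : coord_bounded M (simplex_domain (n k) (p k)).
  move=> x i Ax; apply: (le_trans (coord_bounded_simplex_domain (p01 k) i Ax)).
  by rewrite ler_nat leq_bigmax.
(* If p k0 = 0 and n k0 > 0, the domain of k0 has all coordinates 0. Both it and the product are
   then flat, so both sides vanish. *)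
have [[k0 [pk0 nk0]]|ndeg] := pselect (exists k, p k = 0 /\ n k != 0%N).
  have flat x (i : 'I_(n k0)) : simplex_domain (n k0) (p k0) x -> x i = 0.
    rewrite pk0 => /(simplex_domain_bounded i (lexx 0)).
    by rewrite mulr0 normr_le0 => /eqP.
  have i0 : 'I_(n k0) by exists 0%N; rewrite lt0n.
  have -> : hausdorff (\sum_k n k)%N (set_prod (fun k => simplex_domain (n k)
    (p k))) = 0%E.
    rewrite /hausdorff (hausdorff_flat (M := M) (i := Tagged (fun k => 'I_(n
      k)) i0)) ?mul0e//.
    - rewrite card_tagged sumnE big_map big_enum; apply: eq_bigr => k _;
      exact: card_ord.
    - exact: coord_bounded_set_prod.
    - by move=> x Ax; have := flat _ i0 (Ax k0); rewrite ffunE.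
  rewrite (bigD1 k0)//= {1}/hausdorff (hausdorff_flat (M := M) (i := i0))
    ?mul0e ?card_ord//.
  by move=> x; exact: flat.
have /choice[r hr] : forall k, exists r, 0 < r /\ fat r (simplex_domain (n k)
  (p k)).
  move=> k; have [|r r0 fr] := @fat_simplex_domain R (n k) (p k) (andP (p01
    k)).1.
    by move=> pk; apply/eqP/negPn/negP => nk; apply: ndeg; exists k.
  by exists r.
(* A common margin for all factors: fatness persists when the margin decreases. *)
pose r0 := \big[Num.min/1]_k r k.
have r0_gt0 : 0 < r0.
  by rewrite /r0; elim/big_ind: _ => // [x y x0 y0|k _];
    [rewrite lt_min x0|have [] := hr k].
apply: (hausdorff_set_prod (M := M.+1) (r := r0)) => // [k|k|k].
- exact: card_ord.
- have [_ fk] := hr k; move=> t a y t01 Aa h; apply: (fk t a y t01 Aa) => i.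
  apply: (le_trans (h i)); rewrite ler_wpM2l//; last exact: bigmin_le.
  by case/andP: t01 => _ /ltW; rewrite subr_ge0.
- by move=> x i /bA /le_trans; apply; rewrite ler_nat.
Qed.

End Fibers.

(** * The Boolean cube split by coordinate sum *)

Lemma bits_sum_card d (x : {ffun 'I_d -> bool}) :
  bits_sum x = #|[set i | x i]%SET|.
Proof.
rewrite /bits_sum -sum1_card [RHS]big_mkcond /=.
by apply: eq_bigr => i _; rewrite inE; case: (x i).
Qed.

(** A binary word is the indicator of a subset of ['I_d], whose size is the sum of the word. *)
Lemma card_bits_sum d k :
  #|[set x : {ffun 'I_d -> bool} | bits_sum x == k]%SET| = 'C(d, k).
Proof.
rewrite -[d in RHS]card_ord -card_draws.
pose f (x : {ffun 'I_d -> bool}) := [set i | x i]%SET.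
rewrite -(on_card_preimset (f := f)); last first.
  apply: onW_bij; exists (fun A : {set 'I_d} => [ffun i => i \in A]).
    by move=> x; apply/ffunP => i; rewrite ffunE inE.
  by move=> A; apply/setP => i; rewrite inE ffunE.
by apply: eq_card => x; rewrite !inE bits_sum_card.
Qed.

Lemma bits_sum_le d (x : {ffun 'I_d -> bool}) : (bits_sum x < d.+1)%N.
Proof. by rewrite bits_sum_card ltnS -[leqRHS]card_ord max_card. Qed.

(** Subtraction is truncated, but each binomial coefficient here is positive; adding back d + 1 ones
    restores the expansion of (1 + 1) ^ d. *)
Lemma sum_bin_pred d : (\sum_(k < d.+1) ('C(d, k) - 1) = 2 ^ d - d - 1)%N.
Proof.
have e : (\sum_(k < d.+1) ('C(d, k) - 1) + d.+1 = 2 ^ d)%N.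
  rewrite -[in X in (_ + X)%N](card_ord d.+1) -sum1_card -big_split/=.
  rewrite -[2%N]/(1 + 1)%N expnDn; apply: eq_bigr => k _.
  by rewrite !exp1n !muln1 subnK// bin_gt0 -ltnS.
by rewrite -e -subnDA addn1 addnK.
Qed.

Theorem corollary3p1 (R : realType) (d : nat) (d_ge1 : (1 <= d)%N)
    (p : {ffun 'I_d.+1 -> R}) (p_pmf : is_pmf p) :
  (hausdorff (2 ^ d - d - 1)%N (pmf_with_sum p) =
   \prod_(k < d.+1)
     hausdorff ('C(d, k) - 1)%N (@simplex R ('C(d, k) - 1)%N (p k)))%E.
Proof.
have [p0 p1] := p_pmf.
pose S (x : {ffun 'I_d -> bool}) : 'I_d.+1 := Ordinal (bits_sum_le x).
have cS (k : 'I_d.+1) : #|[set x | S x == k]%SET| = ('C(d, k) - 1).+1.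
  by rewrite subn1 prednK ?bin_gt0 -1?ltnS// -card_bits_sum;
    apply: eq_card => x; rewrite !inE.
have p01 k : 0 <= p k <= 1.
  by rewrite p0 -p1 (bigD1 k)//= lerDl sumr_ge0.
rewrite -sum_bin_pred -(hausdorff_fiber_sums_prod cS p01).
congr hausdorff; apply/seteqP; split => [f [[f0 _] fp]|f [f0 fp]].
  by split => // k; rewrite -fp.
split; last by move=> k; rewrite -fp.
(* The total mass 1 is recovered by summing the fiber masses p k. *)
split => //; rewrite -p1 (partition_big S xpredT)//=.
by apply: eq_bigr => k _; rewrite fp.
Qed.
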